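(* Let $X$ be a complex Banach space, $n\ge1$, $a_1,\ldots,a_n\in\mathbb{C}$, and let $D:\mathcal{C}^n(\mathbb{R},X)\to\mathcal{C}(\mathbb{R},X)$ be $D(y)=y^{(n)}+a_1y^{(n-1)}+\cdots+a_ny$. Suppose the characteristic polynomial $P(z)=z^n+a_1z^{n-1}+\cdots+a_n$ has $n$ distinct roots $r_1,\ldots,r_n$ with $\operatorname{Re} r_k\neq0$ for all $k$, and let $\varepsilon>0$. Let $V=V(r_1,\ldots,r_n)$, $V_k=V(r_1,\ldots,r_{k-1},r_{k+1},\ldots,r_n)$, and define $K$ by: (i) if $\operatorname{Re} r_k>0$ for all $k$: $K=\frac{1}{|V|}\int_0^\infty\Big|\sum_{k=1}^n(-1)^kV_ke^{-r_kx}\Big|dx$; (ii) if $\operatorname{Re} r_k<0$ for all $k$: $K=\frac{1}{|V|}\int_0^\infty\Big|\sum_{k=1}^n(-1)^kV_ke^{r_kx}\Big|dx$; (iii) if, for some $1\le p<n$ (after labeling the roots accordingly), $\operatorname{Re} r_k>0$ for $1\le k\le p$ and $\operatorname{Re} r_k<0$ for $p+1\le k\le n$: $K=\frac{1}{|V|}\int_0^\infty\Big(\Big|\sum_{k=1}^p(-1)^kV_ke^{-r_kx}\Big|+\Big|\sum_{k=p+1}^n(-1)^kV_ke^{r_kx}\Big|\Big)dx$. Then for every $y\in\mathcal{C}^n(\mathbb{R},X)$ with $\|D(y)\|_\infty\le\varepsilon$ there exists a unique $y_H\in\operatorname{Ker}D$ such that $\|y-y_H\|_\infty\le K\varepsi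lon$.
   Context: $\mathcal{C}^n(\mathbb{R},X)$ is the space of $n$ times differentiable functions $\mathbb{R}\to X$ with continuous $n$-th derivative, $\mathcal{C}(\mathbb{R},X)=\mathcal{C}^0(\mathbb{R},X)$; both carry the gauge $\|f\|_\infty=\sup_{t\in\mathbb{R}}\|f(t)\|\in[0,\infty]$. $\operatorname{Ker}D=\{y:D(y)=0\}=\{\sum_{k=1}^nC_ke^{r_kx}: C_k\in X\}$. For numbers $x_1,\ldots,x_m$, $V(x_1,\ldots,x_m)=\det(x_j^{i-1})_{1\le i,j\le m}=\prod_{1\le i<j\le m}(x_j-x_i)$ is the Vandermonde determinant (equal to $1$ when $m\le1$). *)

(* Defs.v *)
From HB Require Import structures.
From mathcomp Require Import all_boot all_order all_algebra.
From mathcomp Require Import all_classical all_reals all_analysis.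
From mathcomp Require Import complex.
Set Implicit Arguments. Unset Strict Implicit. Unset Printing Implicit Defensive.
Import Order.TTheory GRing.Theory Num.Theory ComplexField.
Import numFieldNormedType.Exports.
Local Open Scope ring_scope.
Local Open Scope classical_set_scope.

Section Defs.
Variable R : realType.

Definition expC (z : R[i]) : R[i] :=
  ((expR (complex.Re z))%:C * (cos (complex.Im z) +i* sin (complex.Im z)))%C.

Definition cabs (z : R[i]) : R := Normc.normc z.

Variable X : normedModType R[i].

(* the norm of a vector of X (a nonnegative real, stored in R[i]) as a real *)
Definition xnorm (v : X) : R := complex.Re `|v|.

Definition sup_norm (f : R -> X) : \bar R :=
  ereal_sup (range (fun t => (xnorm (f t))%:E)).

Definition is_deriv (f g : R -> X) : Prop :=
  forall t : R, (fun h : R => ((h%:C)^-1)%C *: (f (t + h) - f t)) @ 0^' --> g t.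

Definition is_Cn (n : nat) (y : R -> X) (ys : nat -> R -> X) : Prop :=
  ys 0%N = y /\ (forall k, (k < n)%N -> is_deriv (ys k) (ys k.+1))
  /\ continuous (ys n).

(* D(y) = y^(n) + a_1 y^(n-1) + ... + a_n y, where a_(i+1) = a i, computed from
   the derivatives ys of y *)
Definition Dop (n : nat) (a : 'I_n -> R[i]) (ys : nat -> R -> X) : R -> X :=
  fun t => ys n t + \sum_(i < n) a i *: ys (n - i.+1)%N t.

Definition charpoly (n : nat) (a : 'I_n -> R[i]) : {poly R[i]} :=
  'X^n + \sum_(i < n) (a i)%:P * 'X^(n - i.+1).

Definition inKer (n : nat) (r : 'I_n -> R[i]) (f : R -> X) : Prop :=
  exists C : 'I_n -> X, f = fun x => \sum_(k < n) expC (r k * x%:C)%C *: C k.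

End Defs.

Definition Vdm (R : realType) (n : nat) (r : 'I_n -> R[i]) : R[i] :=
  \det (Vandermonde n (\row_j r j)).
Definition Vdm_k (R : realType) (n : nat) (r : 'I_n -> R[i]) (k : 'I_n) : R[i] :=
  \det (Vandermonde n.-1 (col' k (\row_j r j))).

(* the constant K; the roots are labeled so that Re r_k > 0 exactly for the
   first p roots (0-indexed k < p).  Case (i): p = n, case (ii): p = 0,
   case (iii): 0 < p < n.  The 1-indexed sign (-1)^k is (-1)^(k+1) here. *)
Definition Kconst (R : realType) (n : nat) (r : 'I_n -> R[i]) (p : nat) : \bar R :=
  let V := Vdm r in
  let term (k : 'I_n) (s : R[i]) (x : R) :=
    ((-1) ^+ k.+1 * Vdm_k r k * expC (s * r k * x%:C)%C) in
  let integrand : R -> R :=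
    if p == n then
      fun x => cabs (\sum_(k < n) term k (-1) x)
    else if p == 0%N then
      fun x => cabs (\sum_(k < n) term k 1 x)
    else
      fun x => cabs (\sum_(k < n | (k < p)%N) term k (-1) x)
             + cabs (\sum_(k < n | (p <= k)%N) term k 1 x) in
  ((cabs V)^-1)%:E * (\int[@lebesgue_measure R]_(x in `[0%R, +oo[) (integrand x)%:E)%E.

(* Main.v *)
Require Import Defs.
From HB Require Import structures.
From mathcomp Require Import all_boot all_order all_algebra.
From mathcomp Require Import all_classical all_reals all_analysis.
From mathcomp Require Import measurable_realfun.
From mathcomp Require Import complex ring lra.
Import Order.TTheory GRing.Theory Num.Theory ComplexField.
Import numFieldNormedType.Exports.
Set Implicit Arguments. Unset Strict Implicit. Unset Printing Implicit Defensive.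
Local Open Scope ring_scope.
Local Open Scope classical_set_scope.

(* Write [f = D(y)] and let [g_k = Q_k(d/dt) y] with [Q_k = P / (z - r_k)], so
   that [g_k' = r_k g_k + f], while the partial fraction coefficients [c_k] of
   [1 / P] give [y = \sum_k c_k g_k].  With [s_k] the sign of [Re r_k], the
   function [exp(- s_k r_k u) g_k(s_k u)] has derivative of size
   [O(exp(- |Re r_k| u))], hence converges to some [C_k] as [u --> +oo], and one
   takes [y_H(t) = \sum_k c_k exp(r_k t) C_k].  For fixed [t],
   [Phi(u) = \sum_k c_k exp(- s_k r_k u) g_k(t + s_k u)] goes from [y(t)] at
   [u = 0] to [y_H(t)] at infinity, and the norm of [Phi'(u)] is at most
   [eps / |V|] times the integrand of [K]; the mean value inequality then
   replaces the integration of vector-valued functions.  Uniqueness holds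
   because [K] is finite and a bounded element of [Ker D] is zero. *)

(** * The norm of a complex normed module as a real number *)

Lemma gt0_complexE (R : rcfType) (e : R[i]) : 0 < e -> e = ((complex.Re e)%:C)%C.
Proof. by case: e => a b; rewrite ltcE /= => /andP[/eqP -> _]. Qed.

Section NormInR.
Variables (R : realType) (X : normedModType R[i]).
Implicit Types (u v w : X) (z : R[i]).

Lemma normE v : `|v| = ((xnorm v)%:C)%C.
Proof.
have := normr_ge0 v.
by rewrite /xnorm; case: `|v| => a b; rewrite lecE /= => /andP[/eqP -> _].
Qed.

Lemma xnorm_ge0 v : 0 <= xnorm v.
Proof. by rewrite -lecR -normE; exact: normr_ge0. Qed.

Lemma xnorm0_eq0 v : xnorm v = 0 -> v = 0.
Proof. by move=> v0; apply/eqP; rewrite -normr_eq0 normE v0. Qed.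

Lemma le_xnormD u v : xnorm (u + v) <= xnorm u + xnorm v.
Proof. by rewrite -lecR rmorphD /= -!normE ler_normD. Qed.

Lemma xnormN v : xnorm (- v) = xnorm v.
Proof. by rewrite /xnorm normrN. Qed.

Lemma xnormB u v : xnorm (u - v) = xnorm (v - u).
Proof. by rewrite -xnormN opprB. Qed.

Lemma xnorm_dist u v : `|xnorm u - xnorm v| <= xnorm (u - v).
Proof.
have H w t : xnorm w - xnorm t <= xnorm (w - t).
  by rewrite lerBlDr (le_trans _ (le_xnormD _ _)) // subrK.
by rewrite ler_norml lerNl opprB H xnormB H.
Qed.

Lemma cabs_normE z : `|z| = ((cabs z)%:C)%C.
Proof. by case: z => a b; rewrite normc_def. Qed.

Lemma xnormZ z v : xnorm (z *: v) = cabs z * xnorm v.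
Proof. by rewrite /xnorm normrZ cabs_normE normE -rmorphM. Qed.

(** The norm of [X] takes values in [R[i]], so radii of balls are complex; a positive complex number
    is real, which moves every convergence question to [R], where squeeze arguments apply. *)
Lemma cvg_xnormP (T : Type) (F : set_system T) {FF : Filter F} (f : T -> X) v :
  f @ F --> v <-> xnorm (v - f x) @[x --> F] --> (0 : R).
Proof.
split=> [/cvgrPdist_lt fv|/cvgrPdist_lt fv]; apply/cvgrPdist_lt => e e0.
  have e0' : 0 < (e%:C)%C by rewrite (ltcR 0).
  apply: filterS (fv _ e0') => x.
  by rewrite normE ltcR sub0r normrN ger0_norm // xnorm_ge0.
have e'E := gt0_complexE e0.
have e0' : 0 < complex.Re e by rewrite -(ltcR 0) -e'E.
apply: filterS (fv _ e0') => x; rewrite [in X in _ -> X]e'E.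
by rewrite normE ltcR sub0r normrN ger0_norm // xnorm_ge0.
Qed.

End NormInR.

Section Cabs.
Variable R : realType.
Implicit Types z w : R[i].

Lemma cabs_xnorm z : cabs z = xnorm (z : R[i]^o).
Proof. by rewrite /xnorm; case: z. Qed.

Lemma cabsM z w : cabs (z * w) = cabs z * cabs w.
Proof. exact: Normc.normcM. Qed.

Lemma cabs_ge0 z : 0 <= cabs z.
Proof. by rewrite cabs_xnorm xnorm_ge0. Qed.

Lemma cabsR (x : R) : cabs (x%:C)%C = `|x|.
Proof. by rewrite /cabs /= expr0n /= addr0 sqrtr_sqr. Qed.

Lemma cabs_le_ReIm (a b : R) : cabs (a +i* b)%C <= `|a| + `|b|.
Proof.
rewrite /cabs /= -(ger0_norm (addr_ge0 (normr_ge0 a) (normr_ge0 b))).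
rewrite -sqrtr_sqr ler_wsqrtr // sqrrD !real_normK ?num_real //.
rewrite -addrA lerD2l lerDr.
by rewrite mulrn_wge0 // mulr_ge0.
Qed.

End Cabs.

(** * A mean value inequality for vector-valued functions *)

(* A point of [[a, b]] is the supremum of the [x] with [phi x <= phi a]; it
   satisfies the same inequality and cannot lie left of [b]. *)
Lemma right_nonincreasing_le (R : realType) (phi : R -> R) (a b : R) :
  a <= b ->
  (forall x, a <= x <= b -> phi (x + h) @[h --> (0 : R)] --> phi x) ->
  (forall x, a <= x < b -> \forall h \near 0^'+, phi (x + h) <= phi x) ->
  phi b <= phi a.
Proof.
move=> ab cphi dphi.
pose S : set R := [set x | (a <= x <= b) /\ phi x <= phi a].
have Sa : S a by rewrite /S /= lexx ab.
have ubS : ubound S b by move=> x [/andP[]].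
have supS : has_sup S by split; [exists a | exists b].
have aS : a <= sup S by apply: sup_upper_bound.
have Sb : sup S <= b by apply: ge_sup => //; exists a.
(* Otherwise continuity keeps [phi] above [phi a] near [sup S], although points of [S] lie
   arbitrarily close to it. *)
have phiS : phi (sup S) <= phi a.
  rewrite leNgt; apply/negP => lt_phi.
  have Hc : phi (sup S + h) @[h --> (0 : R)] --> phi (sup S).
    by apply: cphi; rewrite aS.
  have [d /= d0 Hd] := cvgr_gt _ Hc _ lt_phi.
  have [x [Sx phix] ltx] := sup_adherent d0 supS.
  have lex : x <= sup S by apply: sup_upper_bound.
  have := Hd (x - sup S); rewrite /= sub0r normrN addrCA subrr addr0.
  rewrite ler0_norm ?subr_le0 // opprB ltrBlDr -ltrBlDl => /(_ ltx).
  by rewrite ltNge phix.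
move: Sb; rewrite le_eqVlt => /predU1P[<- //|Sb].
have lt0 : 0 < b - sup S by rewrite subr_gt0.
have [h [[h0 hb] hphi]] : exists h, (0 < h /\ h < b - sup S) /\
    phi (sup S + h) <= phi (sup S).
  apply: (@filter_ex _ 0^'+).
  apply: filterI; last by apply: dphi; rewrite aS.
  by apply: filterI; [exact: nbhs_right_gt | exact: nbhs_right_lt].
have : sup S + h <= sup S.
  apply: sup_upper_bound => //; split; last exact: le_trans phiS.
  by rewrite -lerBrDl (ltW hb) andbT (le_trans aS) // lerDl ltW.
by rewrite gerDl leNgt h0.
Qed.

Section Derivatives.
Variables (R : realType) (X : normedModType R[i]).
Implicit Types (F G : R -> X) (z w : R[i]).

(** Near [x] the difference quotient has norm at most [xnorm (F' x) + 1], hence the increment is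
    dominated by a multiple of [|h|]. *)
Lemma is_deriv_continuous F F' x : is_deriv F F' ->
  F (x + h) @[h --> (0 : R)] --> F x.
Proof.
move=> dF; apply/cvg_xnormP.
have /cvg_xnormP dFx := dF x.
pose M := xnorm (F' x) + 1.
have ltF : \forall h \near (0 : R)^',
    xnorm (F x - F (x + h)) <= `|h| * M.
  move/cvgrPdist_lt : dFx => /(_ 1 ltr01).
  have : \forall h \near (0 : R)^', h != 0 by exact: nbhs_dnbhs_neq.
  apply: filterS2 => h h0; rewrite sub0r normrN ger0_norm ?xnorm_ge0 //= => Hh.
  set q := (_ *: _) in Hh.
  have -> : F x - F (x + h) = - ((h%:C)%C *: q).
    rewrite /q scalerA mulfV ?scale1r ?opprB //.
    by apply: contra h0 => /eqP[->].
  rewrite xnormN xnormZ cabsR ler_wpM2l //.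
  rewrite -[q](subrK (F' x)) (le_trans (le_xnormD _ _)) //.
  by rewrite addrC lerD2l xnormB ltW.
apply: (squeeze_cvgr (f := fun=> 0) (h := fun h : R => `|h| * M)).
- move: ltF; rewrite /dnbhs near_withinE; apply: filterS => h Hh.
  rewrite xnorm_ge0 /=.
  have [->|h0] := eqVneq h 0; last exact: Hh.
  by rewrite addr0 subrr /xnorm normr0 normr0 mul0r.
- exact: cvg_cst.
- have n0 : `|h| @[h --> (0 : R)] --> (0 : R).
    by apply/(@norm_cvg0P R R^o); exact: cvg_id.
  have := @cvgMr_tmp _ _ _ _ _ _ M n0; rewrite mul0r; exact.
Qed.

(** For [e > 0], a small step [t] to the right adds at most [t * (h x + e)] to [xnorm (F u - F a)]
    and at least [t * (h x - e)] to [G]. Subtracting [2 e u] absorbs the gap, so [phi] cannot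
    increase to the right; then [e] tends to 0. *)
Lemma mean_value_le F F' (G h : R -> R) (a b : R) :
  a <= b -> is_deriv F F' ->
  (forall x, a <= x <= b -> is_derive x 1 G (h x)) ->
  (forall x, a <= x <= b -> xnorm (F' x) <= h x) ->
  xnorm (F b - F a) <= G b - G a.
Proof.
move=> ab dF dG leF.
have main e : 0 < e ->
    xnorm (F b - F a) - G b - e *+ 2 * b <= - G a - e *+ 2 * a.
  move=> e0.
  pose phi u := xnorm (F u - F a) - G u - e *+ 2 * u.
  have -> : - G a - e *+ 2 * a = phi a.
    by rewrite /phi subrr /xnorm normr0 /= sub0r.
  apply: (@right_nonincreasing_le _ phi) => // x /andP[ax xb].
    have xt : x + t @[t --> (0 : R)] --> x.
      by rewrite -[X in _ --> X]addr0; apply: cvgD; [exact: cvg_cst|exact: cvg_id].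
    apply: cvgB; last first.
      by apply: cvgMl_tmp; exact: xt.
    apply: cvgB; last first.
      have [/derivable1_diffP/differentiable_continuous cG _] : is_derive x 1 G (h x).
        by apply: dG; rewrite ax.
      apply: (cvg_comp _ _ xt).
      exact: cG.
    have /cvg_xnormP H := is_deriv_continuous (x := x) dF.
    apply/cvgrPdist_lt => eps eps0; move/cvgrPdist_lt : H => /(_ _ eps0).
    apply: filterS => k; rewrite sub0r normrN ger0_norm ?xnorm_ge0 //.
    by apply: le_lt_trans; rewrite (le_trans (xnorm_dist _ _)) // opprB addrA subrK.
  have axb : a <= x <= b by rewrite ax ltW.
  have /cvg_xnormP dFx := cvg_dnbhs_at_right (dF x).
  have [dGx dGE] := dG x axb.
  have := cvg_dnbhs_at_right dGx; rewrite -/(derive G x 1) dGE.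
  move=> /cvgrPdist_lt /(_ _ e0).
  move/cvgrPdist_lt : dFx => /(_ _ e0).
  have : \forall t \near (0 : R)^'+, 0 < t by exact: nbhs_right_gt.
  apply: filterS3 => t t0; rewrite sub0r normrN ger0_norm ?xnorm_ge0 //.
  set q := (_ *: _) => HF; rewrite /= [t *: 1]mulr1 [t^-1 *: _]/(t^-1 * _).
  move=> /ltr_distlBl HG.
  have Fxt : F (x + t) = F x + ((t%:C)%C *: q).
    rewrite /q scalerA mulfV ?scale1r ?subrKC //.
    by rewrite -(rmorph0 (real_complex R)) (inj_eq (@complexI _)) gt_eqF.
  have qle : xnorm q <= h x + e.
    rewrite -[q](subrK (F' x)) (le_trans (le_xnormD _ _)) //.
    by rewrite addrC lerD ?leF // xnormB ltW.
  have Fle : xnorm (F (x + t) - F a) <= xnorm (F x - F a) + t * (h x + e).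
    rewrite Fxt addrAC (le_trans (le_xnormD _ _)) // lerD2l xnormZ cabsR.
    by rewrite gtr0_norm // ler_wpM2l // ltW.
  have Gle : t * (h x - e) <= G (x + t) - G x.
    by rewrite mulrC -ler_pdivlMr // mulrC (addrC x) ltW // HG.
  rewrite /phi; nra.
apply/ler_addgt0Pr => d d0.
(* The accumulated slack is [2 e (b - a)]; this denominator keeps it below [d], and the [+ 1] covers
   [a = b]. *)
have m0 : 0 < (b - a) *+ 2 + 1 by rewrite ltr_wpDl // mulrn_wge0 // subr_ge0.
have e0 : 0 < d / ((b - a) *+ 2 + 1) by rewrite divr_gt0.
have eE : d / ((b - a) *+ 2 + 1) * ((b - a) *+ 2 + 1) = d.
  by rewrite mulfVK // gt_eqF.
have := main _ e0; move: eE e0; set e := d / _ => eE e0; nra.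
Qed.

End Derivatives.

(** * The complex exponential and its derivative at 0 *)

Section Exponential.
Variable R : realType.
Implicit Types (z w : R[i]).

Lemma expC0 : expC (0 : R[i]) = 1.
Proof. by rewrite /expC /= expR0 cos0 sin0 mul1r. Qed.

Lemma expCD z w : expC (z + w) = expC z * expC w.
Proof.
case: z w => a b [c d]; rewrite /expC /= expRD cosD sinD.
by apply/eqP; rewrite eq_complex /=; apply/andP; split; apply/eqP; ring.
Qed.

Lemma expC_mulD w (t s : R) :
  expC (w * ((t + s)%:C)%C) = expC (w * (s%:C)%C) * expC (w * (t%:C)%C).
Proof. by rewrite rmorphD /= mulrDr expCD mulrC. Qed.

Lemma cabs_expC z : cabs (expC z) = expR (complex.Re z).
Proof.
rewrite /expC cabsM cabsR ger0_norm ?expR_ge0 // /cabs /=.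
by rewrite cos2Dsin2 sqrtr1 mulr1.
Qed.

Lemma Re_mulr_real z (x : R) : complex.Re (z * (x%:C)%C) = complex.Re z * x.
Proof. by case: z => a b /=; rewrite mulr0 subr0. Qed.

Lemma cvg_complex (T : Type) (F : set_system T) {FF : Filter F}
  (f g : T -> R) (a b : R) :
  f @ F --> a -> g @ F --> b ->
  ((f x +i* g x)%C : R[i]^o) @[x --> F] --> ((a +i* b)%C : R[i]^o).
Proof.
move=> fa gb; apply/cvg_xnormP.
have -> : (0 : R) = `|a - a| + `|b - b| by rewrite !subrr normr0 addr0.
apply: (squeeze_cvgr (f := fun=> 0) (h := fun x => `|a - f x| + `|b - g x|)).
- by apply: nearW => x; rewrite xnorm_ge0 -cabs_xnorm cabs_le_ReIm.
- by rewrite !subrr normr0 addr0; exact: cvg_cst.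
- by apply: cvgD; apply: cvg_norm; apply: cvgB => //; exact: cvg_cst.
Qed.

(** Real and imaginary parts are differentiated separately as real functions; [expCD] carries the
    result from 0 to any other point. *)
Lemma cvg_expC_quotient w :
  (((h%:C)^-1)%C * (expC (w * (h%:C)%C) - 1) : R[i]^o) @[h --> (0 : R)^']
    --> (w : R[i]^o).
Proof.
case: w => a b.
pose f h : R := expR (a * h) * cos (b * h).
pose g h : R := expR (a * h) * sin (b * h).
have dl (c : R) : is_derive (0 : R) 1 (fun h => c * h) c.
  have := @is_deriveZ R R^o R^o id c 0 1 1 (is_derive_id _ _).
  by rewrite [c *: 1]mulr1.
have df : is_derive (0 : R) 1 f a.
  have := @is_deriveM R R^o _ _ 0 1 _ _
     (@is_derive1_comp R expR (fun h => a * h) 0 _ _ (is_derive_expR _) (dl a))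
     (@is_derive1_comp R cos (fun h => b * h) 0 _ _ (is_derive_cos _) (dl b)).
  rewrite /= !mulr0 expR0 cos0 sin0 oppr0 mul0r scaler0 add0r mul1r.
  by rewrite [1 *: a]mul1r.
have dg : is_derive (0 : R) 1 g b.
  have := @is_deriveM R R^o _ _ 0 1 _ _
     (@is_derive1_comp R expR (fun h => a * h) 0 _ _ (is_derive_expR _) (dl a))
     (@is_derive1_comp R sin (fun h => b * h) 0 _ _ (is_derive_sin _) (dl b)).
  rewrite /= !mulr0 expR0 cos0 sin0 scale0r addr0 mul1r.
  by rewrite [1 *: b]mul1r.
have [df1 df2] := df; have [dg1 dg2] := dg.
move: df1 dg1; rewrite /derivable => df1 dg1.
have dfg := cvg_complex df1 dg1.
rewrite -/(derive f 0 1) -/(derive g 0 1) df2 dg2 in dfg.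
pose q (k : R -> R) (h : R) : R :=
  h^-1 *: ((k \o shift 0) (h *: (1 : R)) - k 0 : R^o).
have E (h : R) : (((h%:C)^-1)%C * (expC ((a +i* b)%C * (h%:C)%C) - 1) : R[i]^o)
   = (q f h +i* q g h)%C.
  have qE k : q k h = h^-1 * (k h - k 0).
    by rewrite /q /= addr0 [h *: 1]mulr1.
  rewrite !qE /f /g !mulr0 expR0 cos0 sin0 !mulr1 mulr0 subr0.
  rewrite -(fmorphV (real_complex R)) /expC /= !mulr0 !subr0 !add0r.
  by apply/eqP; rewrite eq_complex /=; apply/andP; split; apply/eqP; ring.
under eq_fun do rewrite E.
exact: dfg.
Qed.

End Exponential.

(** * Rules of differentiation for [is_deriv] *)

Section DerivativeRules.
Variables (R : realType) (X : normedModType R[i]).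
Implicit Types (F G : R -> X) (z w : R[i]).

Lemma is_derivZ z F F' :
  is_deriv F F' -> is_deriv (fun t => z *: F t) (fun t => z *: F' t).
Proof.
move=> dF t; under eq_fun do rewrite -scalerBr scalerA mulrC -scalerA.
by apply: cvgZl_tmp; exact: dF.
Qed.

Lemma is_deriv_sum (I : finType) (P : pred I) (F F' : I -> R -> X) :
  (forall i, is_deriv (F i) (F' i)) ->
  is_deriv (fun t => \sum_(i | P i) F i t) (fun t => \sum_(i | P i) F' i t).
Proof.
move=> dF t; under eq_fun do rewrite -sumrB scaler_sumr.
apply: cvg_big => [|i _]; [exact: add_continuous|exact: dF].
Qed.

Lemma is_deriv_reparam F F' (t s : R) : s != 0 ->
  is_deriv F F' ->
  is_deriv (fun u => F (t + s * u)) (fun u => (s%:C)%C *: F' (t + s * u)).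
Proof.
move=> s0 dF u.
have sh0 : s * h @[h --> (0 : R)^'] --> (0 : R)^'.
  have := @continuous_injective_withinNx R R ( *%R s) 0; rewrite mulr0; apply.
    exact: mulrl_continuous.
  by move=> h /eqP; rewrite mulf_eq0 (negPf s0) /= => /eqP.
have q (h : R) : (h%:C)%C^-1 *: (F (t + s * (u + h)) - F (t + s * u)) =
   (s%:C)%C *: (((s * h)%:C)%C^-1 *: (F (t + s * u + s * h) - F (t + s * u))).
  rewrite mulrDr addrA scalerA rmorphM /= invfM mulrA divff ?mul1r //.
  by apply: contra s0 => /eqP[->].
under eq_fun do rewrite q.
apply: cvgZl_tmp.
exact: (cvg_comp _ _ sh0 (dF (t + s * u))).
Qed.

Lemma is_deriv_expC w G G' : is_deriv G G' ->
  is_deriv (fun u => expC (w * (u%:C)%C) *: G u)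
           (fun u => expC (w * (u%:C)%C) *: (w *: G u + G' u)).
Proof.
move=> dG u.
(* The product rule at the level of quotients: the factor [expC (w * u)] comes out, leaving the
   quotient of [G] and the quotient of the exponential at 0 times [G (u + h)]. *)
have q (h : R) : ((h%:C)^-1)%C *: (expC (w * ((u + h)%:C)%C) *: G (u + h)
      - expC (w * (u%:C)%C) *: G u)
    = expC (w * (u%:C)%C) *: (((h%:C)^-1)%C *: (G (u + h) - G u)
       + (((h%:C)^-1)%C * (expC (w * (h%:C)%C) - 1)) *: G (u + h)).
  rewrite rmorphD /= mulrDr expCD.
  move: (expC _) (expC _) (_^-1)%C => E e k.
  rewrite -scalerA -scalerBr !scalerA mulrC -!scalerA -scalerDr.
  by do 2![congr (_ *: _)]; rewrite scalerBl scale1r [RHS]addrC addrA subrK.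
under eq_fun do rewrite q.
apply: cvgZl_tmp; rewrite addrC; apply: cvgD; first exact: dG.
apply: (@cvgZ R[i]); first exact: cvg_expC_quotient.
by apply: (cvg_within_filter (F := nbhs (0 : R))); exact: is_deriv_continuous dG.
Qed.

End DerivativeRules.

(** * Partial fractions of the inverse of the characteristic polynomial *)

Section PartialFractions.
Variable R : realType.
Implicit Types (n : nat) (P : {poly R[i]}) (z : R[i]).

Lemma Vdm_neq0 n (r : 'I_n -> R[i]) : injective r -> Vdm r != 0.
Proof.
move=> rI; rewrite /Vdm det_Vandermonde; apply/prodf_neq0 => i _.
apply/prodf_neq0 => j ij; rewrite !mxE subr_eq0.
by apply: contraTneq ij => /rI ->; rewrite ltnn.
Qed.

(** The sign is that of a cofactor along the last row of the Vandermonde matrix. Up to the common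
    factor [(-1)^n / V], these are the coefficients [(-1)^k V_k] occurring in [K]. *)
Definition pfrac n (r : 'I_n -> R[i]) (k : 'I_n) : R[i] :=
  (-1) ^+ (n + k.+1) * Vdm_k r k / Vdm r.

(* The numbers [pfrac r k] form the last column of the inverse Vandermonde
   matrix; equivalently [1 / P(z) = \sum_k pfrac r k / (z - r k)]. *)
Lemma sum_pfrac n (r : 'I_n -> R[i]) (i : nat) : injective r -> (i < n)%N ->
  \sum_k pfrac r k * r k ^+ i = (i.+1 == n)%:R.
Proof.
case: n r => [//|m] r rI im.
have V0 := Vdm_neq0 rI.
set A := Vandermonde m.+1 (\row_j r j).
have cof k : cofactor A ord_max k = (-1) ^+ (m.+1 + k.+1) * Vdm_k r k.
  rewrite /cofactor /Vdm_k addSn addnS !exprS !mulN1r opprK /=.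
  congr (_ * \det _).
  by apply/matrixP => u v; rewrite !mxE lift_max.
have := congr1 (fun M : 'M[R[i]]_(m.+1) => M (Ordinal im) ord_max) (mul_mx_adj A).
rewrite !mxE -/(Vdm r) -val_eqE /= => AE; rewrite eqSS.
apply: (mulIf V0); rewrite mulr_natl -AE mulr_suml; apply: eq_bigr => k _.
by rewrite !mxE cof mulrAC mulfVK // mulrC.
Qed.

Lemma coef_charpoly n (a : 'I_n -> R[i]) (j : nat) :
  (charpoly a)`_j = (j == n)%:R + \sum_(i < n) a i * (j == n - i.+1)%N%:R.
Proof.
rewrite /charpoly coefD coefXn coef_sum; congr (_ + _).
by apply: eq_bigr => i _; rewrite mul_polyC coefZ coefXn.
Qed.

Lemma coef_charpoly_n n (a : 'I_n -> R[i]) : (charpoly a)`_n = 1.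
Proof.
rewrite coef_charpoly eqxx big1 ?addr0 // => i _.
by rewrite gtn_eqF ?mulr0 // -subSn ?subSS ?leq_subr // ltnS leq_subr.
Qed.

(** With [v j = ys j t], this reads [Dop] as the polynomial [charpoly a] applied to
    differentiation. *)
Lemma sum_charpoly n (a : 'I_n -> R[i]) (V : lmodType R[i]) (v : nat -> V) :
  \sum_(j < n.+1) (charpoly a)`_j *: v j
  = v n + \sum_(i < n) a i *: v (n - i.+1)%N.
Proof.
under eq_bigr do rewrite coef_charpoly scalerDl scaler_suml.
rewrite big_split /=; congr (_ + _).
  rewrite big_ord_recr /= eqxx scale1r big1 ?add0r // => j _.
  by rewrite ltn_eqF ?scale0r.
rewrite exchange_big /=; apply: eq_bigr => i _.
have lt : (n - i.+1 < n.+1)%N by rewrite ltnS leq_subr.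
rewrite (bigD1 (Ordinal lt)) //= eqxx mulr1 big1 ?addr0 // => j.
by rewrite -val_eqE /= => /negPf ->; rewrite mulr0 scale0r.
Qed.

Lemma size_charpoly n (a : 'I_n -> R[i]) : (size (charpoly a) <= n.+1)%N.
Proof.
rewrite (leq_trans (size_polyD _ _)) // geq_max size_polyXn leqnn /=.
apply: (leq_trans (size_sum _ _ _)); apply/bigmax_leqP => i _.
rewrite mul_polyC (leq_trans (size_scale_leq _ _)) // size_polyXn.
by rewrite ltnS leq_subr.
Qed.

(* Coefficient of ['X^i] in the quotient [(P - P.[z]) / ('X - z)]. *)
Definition quot_coef n (P : {poly R[i]}) (z : R[i]) (i : nat) : R[i] :=
  \sum_(j < n - i) P`_((i + j).+1) * z ^+ j.

(** Synthetic division: compare the coefficients of degree [i + 1] in [P = ('X - z) Q + P.[z]]. *)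
Lemma quot_coef_rec n P z i : (i < n)%N ->
  quot_coef n P z i = P`_i.+1 + z * quot_coef n P z i.+1.
Proof.
move=> ltin; rewrite /quot_coef -subSS subSn // big_ord_recl /= addn0 mulr1.
congr (_ + _); rewrite mulr_sumr; apply: eq_bigr => j _.
by rewrite /bump leq0n add1n addnS addSn exprS mulrCA.
Qed.

Lemma quot_coef0 n P z : (size P <= n.+1)%N -> root P z ->
  P`_0 + z * quot_coef n P z 0 = 0.
Proof.
move=> sP /rootP; rewrite (horner_coef_wide _ sP) big_ord_recl mulr1 => {2}<-.
congr (_ + _); rewrite /quot_coef subn0 mulr_sumr; apply: eq_bigr => j _.
by rewrite lift0 add0n exprS mulrCA.
Qed.

(** This is ['X * Q = P + z Q] for [Q = P / ('X - z)], with ['X^i] replaced by [v i]. *)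
Lemma sum_quot_coef n P z (V : lmodType R[i]) (v : nat -> V) :
  (size P <= n.+1)%N -> root P z ->
  \sum_(i < n) quot_coef n P z i *: v i.+1
  = \sum_(i < n.+1) P`_i *: v i + z *: \sum_(i < n) quot_coef n P z i *: v i.
Proof.
move=> sP rP; have qn : quot_coef n P z n = 0 by rewrite /quot_coef subnn big_ord0.
have -> : \sum_(i < n) quot_coef n P z i *: v i
    = \sum_(i < n.+1) quot_coef n P z i *: v i.
  by rewrite big_ord_recr /= qn scale0r addr0.
rewrite scaler_sumr -big_split big_ord_recl /=.
rewrite scalerA -scalerDl quot_coef0 // scale0r add0r.
by apply: eq_bigr => i _; rewrite scalerA -scalerDl -quot_coef_rec.
Qed.

(** Coefficientwise form of [\sum_k c_k P / ('X - r_k) = 1]. By [sum_pfrac], only the power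
    [r k ^+ (n - 1)] contributes; it occurs for [i = 0] alone, multiplied by the leading coefficient
    1 of [P]. *)
Lemma sum_pfrac_quot n (a : 'I_n -> R[i]) (r : 'I_n -> R[i]) i :
  injective r -> (i < n)%N ->
  \sum_k pfrac r k * quot_coef n (charpoly a) (r k) i = (i == 0)%:R.
Proof.
move=> rI ltin; under eq_bigr do rewrite /quot_coef mulr_sumr.
rewrite exchange_big /=.
under eq_bigr => j _.
  under eq_bigr do rewrite mulrCA.
  rewrite -mulr_sumr sum_pfrac //; first over.
  by rewrite (leq_trans (ltn_ord j)) // leq_subr.
case: i ltin => [|i] ltin.
  case: n a r rI ltin => [//|m] a r rI _.
  rewrite subn0 big_ord_recr /= eqxx add0n coef_charpoly_n mulr1 big1 ?add0r //.
  by move=> j _; rewrite eqSS ltn_eqF ?mulr0.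
rewrite big1 // => j _; rewrite ltn_eqF ?mulr0 //.
by have := ltn_ord j; rewrite ltn_subRL; apply: leq_trans; rewrite addSn !ltnS leq_addl.
Qed.

End PartialFractions.

(** * Bounded exponential sums vanish *)

Section Uniqueness.
Variable R : realType.

(** Write [z - w = a + i b]. If [a = 0], the exponential equals -1 at [s = pi / b]; otherwise its
    modulus at [s = 1] is [exp a], which is not 1. *)
Lemma expC_separates (z w : R[i]) : z != w ->
  exists s : R, expC (z * (s%:C)%C) != expC (w * (s%:C)%C).
Proof.
move=> zw; suff [s Hs] : exists s : R, expC ((z - w) * (s%:C)%C) != 1.
  exists s; apply: contraNneq Hs => H.
  by rewrite mulrBl expCD H -expCD subrr expC0.
have : z - w != 0 by rewrite subr_eq0.
case: (z - w) => a b; rewrite eq_complex /= negb_and => ab.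
have [a0|a0] := eqVneq a 0.
  move: ab; rewrite a0 eqxx /= => b0; exists (pi / b).
  rewrite /expC /= !mul0r mulr0 subr0 add0r mulrCA divff // mulr1 expR0.
  rewrite cospi sinpi mul1r; apply/negP; rewrite eq_complex /= eqxx andbT.
  by rewrite lt_eqF // ltrNl (lt_trans (ltrN10 R)) ?ltr01.
exists 1; apply: contraNneq a0 => /(congr1 (@cabs R)).
rewrite cabs_expC Re_mulr_real mulr1.
have -> : cabs 1 = 1 :> R by exact: Normc.normc1.
by move=> /(congr1 (@ln R)) /=; rewrite expRK ln1 => ->.
Qed.

(* Induction on the support: [f (t + s) - expC (r k0 * s) *: f t] is a bounded
   exponential sum without the frequency [r k0]. *)
Lemma bounded_exp_sum (X : normedModType R[i]) (I : finType) (r : I -> R[i])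
  (A : {set I}) (D : I -> X) (M : R) :
  injective r -> (forall k, complex.Re (r k) != 0) ->
  (forall t : R, xnorm (\sum_(k in A) expC (r k * (t%:C)%C) *: D k) <= M) ->
  forall k, k \in A -> D k = 0.
Proof.
move=> rI r0; have [m] := ubnP #|A|; elim: m => // m IHm in A D M *.
rewrite ltnS => leAm bM k kA.
have shift k0 : k0 \in A -> forall j, j \in A -> j != k0 -> D j = 0.
  move=> k0A j jA jk0.
  have [s Hs] : exists s : R, expC (r j * (s%:C)%C) != expC (r k0 * (s%:C)%C).
    by apply: expC_separates; apply: contra jk0 => /eqP/rI ->.
  pose D' i := (expC (r i * (s%:C)%C) - expC (r k0 * (s%:C)%C)) *: D i.
  have : D' j = 0.
    apply: (IHm (A :\ k0) D' (M + cabs (expC (r k0 * (s%:C)%C)) * M)).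
    - by rewrite (leq_trans _ leAm) // [X in (_ < X)%N](cardsD1 k0) k0A.
    - move=> t.
      have -> : \sum_(i in A :\ k0) expC (r i * (t%:C)%C) *: D' i
          = \sum_(i in A) expC (r i * ((t + s)%:C)%C) *: D i
            - expC (r k0 * (s%:C)%C) *: \sum_(i in A) expC (r i * (t%:C)%C) *: D i.
        rewrite scaler_sumr -sumrB [RHS](big_setD1 k0) // scalerA -scalerBl.
        rewrite expC_mulD subrr scale0r [RHS]add0r; apply: eq_bigr => i _.
        by rewrite /D' !scalerA -scalerBl expC_mulD -mulrBl mulrC.
      rewrite (le_trans (le_xnormD _ _)) // xnormN xnormZ lerD //.
      by rewrite ler_wpM2l // cabs_ge0.
    - by rewrite !inE jk0.
  by move/eqP; rewrite scaler_eq0 subr_eq0 (negPf Hs) /= => /eqP.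
have bk (t : R) : xnorm (expC (r k * (t%:C)%C) *: D k) <= M.
  have := bM t; rewrite (big_setD1 k) //= big1 ?addr0 // => j.
  by rewrite !inE => /andP[jk jA]; rewrite (shift k) ?scaler0.
apply: xnorm0_eq0; apply/eqP; apply: contraT => d0.
have dpos : 0 < xnorm (D k) by rewrite lt_neqAle eq_sym d0 xnorm_ge0.
(* At this time the exponential has modulus [exp (M / xnorm (D k))], at least [1 + M / xnorm (D k)],
   so the remaining term would have norm at least [M + xnorm (D k)], above the bound [M]. *)
have := bk (M / xnorm (D k) / complex.Re (r k)).
rewrite xnormZ cabs_expC Re_mulr_real mulrCA divff // mulr1 => leM.
have := le_trans (ler_wpM2r (ltW dpos) (expR_ge1Dx (M / xnorm (D k)))) leM.
by rewrite mulrDl mul1r divfK ?gt_eqF // gerDr leNgt dpos.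
Qed.

End Uniqueness.

(** * Improper integrals over the half-line *)

Section Integrals.
Variable R : realType.
Local Notation mu := (@lebesgue_measure R).

(** Stop at a [b] where [F b] is within [e] of [L], and apply the mean value inequality on [[0, b]]
    with a primitive of [h]. *)
Lemma integral_dominates_increment (X : normedModType R[i]) (F F' : R -> X)
  (h : R -> R) (L : X) :
  is_deriv F F' -> continuous h -> (forall u, 0 <= h u) ->
  (forall u, 0 <= u -> xnorm (F' u) <= h u) ->
  F u @[u --> +oo] --> L ->
  ((xnorm (L - F 0))%:E <= \int[mu]_(u in `[0%R, +oo[) (h u)%:E)%E.
Proof.
move=> dF ch h0 leF FL; apply/lee_addgt0Pr => e e0.
have [b [b0 Lb]] : exists b : R, 0 < b /\ xnorm (L - F b) < e.
  apply: (@filter_ex _ (pinfty_nbhs R)).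
  apply: filterI; first exact: nbhs_pinfty_gt.
  move/cvg_xnormP : FL => /cvgrPdist_lt /(_ _ e0).
  by apply: filterS => u; rewrite sub0r normrN ger0_norm // xnorm_ge0.
have mh : measurable_fun setT h by exact: continuous_measurable_fun.
have ih x : mu.-integrable `[-1, x]%classic (EFin \o h).
  apply: continuous_compact_integrable; first exact: segment_compact.
  exact: continuous_subspaceT.
(* Starting the primitive at -1 makes 0 an interior point, so that [G] has a two-sided derivative
   there. *)
pose G x := Rintegral mu `[-1, x]%classic h.
have dG x : 0 <= x <= b -> is_derive x 1 G (h x).
  move=> /andP[x0 _].
  have [||] := @continuous_FTC1_closed R h (-1) x (x + 1) _ (ih _) _ (ch x).
  - by rewrite ltrDl.
  - by rewrite (lt_le_trans _ x0) // ltrN10.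
  by move=> d1 d2; apply: DeriveDef; [exact: d1 | rewrite -derive1E; exact: d2].
have le1 : xnorm (F b - F 0) <= G b - G 0.
  by apply: (mean_value_le (ltW b0) dF dG) => u /andP[/leF].
have le2 : ((G b - G 0)%:E <= \int[mu]_(u in `[0%R, +oo[) (h u)%:E)%E.
  rewrite /G Rintegral_itvB //=; last 2 first.
  - by rewrite bnd_simp lerN10.
  - by rewrite bnd_simp ltW.
  rewrite /Rintegral fineK; last first.
    apply: integrable_fin_num => //; apply: integrableS (ih b) => //.
    by apply: subset_itvr; rewrite bnd_simp.
  apply: ge0_subset_integral => //.
  - by apply/measurable_EFinP; exact: measurable_funTS.
  - by move=> u _; rewrite lee_fin.
  - by apply: subset_itv; rewrite bnd_simp.
apply: le_trans (leeD le2 (lexx _)); rewrite -EFinD lee_fin.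
rewrite -(subrK (F b) L) -addrA addrC (le_trans (le_xnormD _ _)) //.
by rewrite lerD // ltW.
Qed.

Lemma is_derive_expRM (c d x : R) :
  is_derive x 1 (fun u => c * expR (d * u)) (c * d * expR (d * x)).
Proof.
have dl : is_derive x 1 (fun u : R => d * u) d.
  have := @is_deriveZ R R^o R^o id d x 1 1 (is_derive_id _ _).
  by rewrite [d *: 1]mulr1.
have D := @is_deriveZ R R^o R^o (expR \o (fun u => d * u)) c x 1 _
  (@is_derive1_comp R expR _ x _ _ (is_derive_expR _) dl).
have -> : c * d * expR (d * x) = c *: (expR (d * x) * d : R^o).
  by rewrite [c *: _]/(c * _) -mulrA [d * expR _]mulrC.
exact: D.
Qed.

Lemma cvg_expRMy (d : R) : 0 < d -> expR (- d * u) @[u --> +oo] --> (0 : R).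
Proof.
move=> d0; under eq_fun do rewrite mulNr.
apply: (cvg_comp (fun u : R => d * u) (fun u : R => expR (- u)) _ (@cvgr_expR R)).
by apply: gt0_cvgMry => //; exact: cvg_id.
Qed.

Lemma integral_exp_lty (h : R -> R) (M d : R) : 0 < d ->
  continuous h -> (forall u, 0 <= u -> 0 <= h u <= M * expR (- d * u)) ->
  (\int[mu]_(u in `[0%R, +oo[) (h u)%:E < +oo)%E.
Proof.
move=> d0 ch leh.
have M0 : 0 <= M.
  have := leh 0 (lexx 0); rewrite mulr0 expR0 mulr1 => /andP[].
  exact: le_trans.
have cexp : continuous (fun u : R => M * expR (- d * u)).
  move=> u; apply: cvgMl_tmp; apply: (cvg_comp _ expR); last exact: continuous_expR.
  exact: mulrl_continuous.
apply: (@le_lt_trans _ _ (\int[mu]_(u in `[0%R, +oo[) (M * expR (- d * u))%:E)%E).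
  have itv_ge0 u : `[0%R, +oo[%classic u -> 0 <= u by rewrite /= in_itv /= andbT.
  apply: ge0_le_integral => //.
  - by move=> u /itv_ge0/leh /andP[]; rewrite lee_fin.
  - by apply/measurable_EFinP; apply: measurable_funTS; exact: continuous_measurable_fun.
  - by apply/measurable_EFinP; apply: measurable_funTS; exact: continuous_measurable_fun.
  - by move=> u /itv_ge0/leh /andP[]; rewrite lee_fin.
have dE (x : R) :
    is_derive x 1 (fun u => - (M / d) * expR (- d * u)) (M * expR (- d * x)).
  by have := is_derive_expRM (- (M / d)) (- d) x; rewrite mulrNN divfK ?gt_eqF.
rewrite (@ge0_continuous_FTC2y _ _ (fun u => - (M / d) * expR (- d * u)) _ 0).
- by rewrite -EFinB ltry.
- by move=> x _; rewrite mulr_ge0 // expR_ge0.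
- exact: continuous_subspaceT.
- rewrite -(mulr0 (- (M / d))); apply: cvgMl_tmp; exact: cvg_expRMy.
- by move=> x _; case: (dE x).
- apply: cvg_at_right_filter.
  by have [/derivable1_diffP/differentiable_continuous c _] := dE 0; exact: c.
- by move=> x _; rewrite derive1E; have [_ ->] := dE x.
Qed.

End Integrals.

(** * The integrand of [K] and its integrability *)

Section Kernel.
Variable R : realType.
Local Notation mu := (@lebesgue_measure R).

Definition exp_sum (I : finType) (P : pred I) (c w : I -> R[i]) (u : R) : R[i] :=
  \sum_(i | P i) c i * expC (w i * (u%:C)%C).

Lemma continuous_cabs_exp_sum (I : finType) (P : pred I) (c w : I -> R[i]) :
  continuous (fun u => cabs (exp_sum P c w u)).
Proof.
(* Continuity is obtained from differentiability; the [+ 0] is the derivative of the constant [c i]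
   in the shape given by [is_deriv_expC]. *)
have dE : is_deriv (X := R[i]^o) (exp_sum P c w)
    (fun u => \sum_(i | P i) expC (w i * (u%:C)%C) *: (w i *: c i + 0)).
  have -> : exp_sum P c w = fun u => \sum_(i | P i) expC (w i * (u%:C)%C) *: (c i : R[i]^o).
    by apply/funext => u; apply: eq_bigr => i _; rewrite mulrC.
  apply: is_deriv_sum => i; apply: is_deriv_expC => t.
  by under eq_fun do rewrite subrr scaler0; exact: cvg_cst.
have E : (fun u => cabs (exp_sum P c w u)) =
    (fun u => xnorm (exp_sum P c w u : R[i]^o)).
  by apply/funext => u; rewrite cabs_xnorm.
rewrite E => x.
have Hc : xnorm (exp_sum P c w (x + h) : R[i]^o) @[h --> (0 : R)] -->
    xnorm (exp_sum P c w x : R[i]^o).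
  have /cvg_xnormP/cvgrPdist_lt H := is_deriv_continuous (x := x) dE.
  apply/cvgrPdist_lt => e e0; apply: filterS (H e e0) => h.
  rewrite sub0r normrN ger0_norm ?xnorm_ge0 //.
  exact: le_lt_trans (xnorm_dist _ _).
have x0 : u - x @[u --> x] --> (0 : R).
  by rewrite -[X in _ --> X](subrr x); apply: cvgB; [exact: cvg_id|exact: cvg_cst].
have -> : (fun u => xnorm (exp_sum P c w u : R[i]^o)) =
    (fun h => xnorm (exp_sum P c w (x + h) : R[i]^o)) \o (fun u => u - x).
  by apply/funext => u /=; rewrite subrKC.
rewrite /prop_for /continuous_at /= subrr addr0; exact: cvg_comp x0 Hc.
Qed.

Lemma cabs_exp_sum_le (I : finType) (P : pred I) (c w : I -> R[i]) (d u : R) :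
  (forall i, P i -> complex.Re (w i) <= - d) -> 0 <= u ->
  cabs (exp_sum P c w u) <= (\sum_(i | P i) cabs (c i)) * expR (- d * u).
Proof.
move=> wd u0; rewrite /exp_sum mulr_suml.
elim/big_rec2: _ => [|i b z Pi zb]; first by rewrite [cabs 0]Normc.normc0.
rewrite cabs_xnorm (le_trans (le_xnormD (_ : R[i]^o) _)) // -!cabs_xnorm lerD //.
by rewrite cabsM cabs_expC Re_mulr_real ler_wpM2l ?cabs_ge0 // ler_expR ler_wpM2r ?wd.
Qed.

Definition kernel_coef n (r : 'I_n -> R[i]) (k : 'I_n) : R[i] :=
  (-1) ^+ k.+1 * Vdm_k r k.

(** The integrand of the mixed case. When [p = n] or [p = 0] one of the sums is empty, so this
    single formula serves all three cases of [Kconst]. *)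
Definition kernel n (r : 'I_n -> R[i]) (p : nat) (u : R) : R :=
  cabs (exp_sum (fun k : 'I_n => (k < p)%N) (kernel_coef r) (fun k => -1 * r k) u) +
  cabs (exp_sum (fun k : 'I_n => (p <= k)%N) (kernel_coef r) (fun k => 1 * r k) u).

Lemma kernel_ge0 n (r : 'I_n -> R[i]) p u : 0 <= kernel r p u.
Proof. by rewrite addr_ge0 ?cabs_ge0. Qed.

Lemma continuous_kernel n (r : 'I_n -> R[i]) p : continuous (kernel r p).
Proof. by move=> u; apply: cvgD; exact: continuous_cabs_exp_sum. Qed.

Lemma Kconst_kernel n (r : 'I_n -> R[i]) p : (0 < n)%N ->
  Kconst r p = (((cabs (Vdm r))^-1)%:E *
                \int[mu]_(u in `[0%R, +oo[) (kernel r p u)%:E)%E.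
Proof.
move=> n0; rewrite /Kconst; congr (_ * _)%E; apply: eq_integral => u _.
congr (_ %:E); rewrite /kernel /exp_sum.
case: eqP => [->|_].
  rewrite [X in _ + cabs X]big1 ?[cabs 0]Normc.normc0 ?addr0.
    by congr cabs; apply: eq_bigl => k; rewrite ltn_ord.
  by move=> k; rewrite leqNgt ltn_ord.
case: eqP => [->|_ //].
by rewrite [X in cabs X + _]big1 ?[cabs 0]Normc.normc0 ?add0r.
Qed.

Lemma Re_roots_gap n (r : 'I_n -> R[i]) :
  (forall k, complex.Re (r k) != 0) ->
  exists2 d : R, 0 < d & forall k, d <= `|complex.Re (r k)|.
Proof.
(* The default value 1 keeps the minimum positive for an empty family. *)
move=> r0; exists (\big[Num.min/1]_k `|complex.Re (r k)|).
  by apply/bigmin_gtP; split => // k _; rewrite normr_gt0.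
by move=> k; exact: bigmin_le.
Qed.

(** If [d > 0] bounds every [|Re r_k|] from below, all exponents in [kernel] have real part at most
    [- d], so [kernel] is dominated by a multiple of [exp (- d u)]. *)
Lemma integral_kernel_lty n (r : 'I_n -> R[i]) p :
  (forall k, complex.Re (r k) != 0) ->
  (forall k : 'I_n, (0 < complex.Re (r k)) = (k < p)%N) ->
  (\int[mu]_(u in `[0%R, +oo[) (kernel r p u)%:E < +oo)%E.
Proof.
move=> r0 rp; have [d d0 rd] := Re_roots_gap r0.
apply: (integral_exp_lty d0 (@continuous_kernel _ r p)) => u u0.
rewrite kernel_ge0 /=.
apply: le_trans (lerD (cabs_exp_sum_le (d := d) _ _ u0) (cabs_exp_sum_le (d := d) _ _ u0)) _.
- move=> k kp; have := rd k; rewrite mulN1r gtr0_norm ?rp // => rk.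
  by case: (r k) rk => x y /=; rewrite lerN2.
- move=> k; rewrite leqNgt -rp -leNgt mul1r => rk.
  by have := rd k; rewrite ler0_norm // lerNr.
by rewrite -mulrDl.
Qed.

End Kernel.

(** * A first-order equation with its integrating factor *)

Section WeightedFactor.
Variables (R : realType) (X : completeNormedModType R[i]).
Variables (g f : R -> X) (z : R[i]) (s eps : R).
Hypotheses (ss : s * s = 1) (dg : is_deriv g (fun t => z *: g t + f t)).

Local Notation w := (- (s%:C)%C * z).

(** The weight is an integrating factor: its derivative contributes [- s z g], which cancels the
    [s z g] coming from [g' = z g + f]. *)
Lemma is_deriv_weighted t :
  is_deriv (fun u => expC (w * (u%:C)%C) *: g (t + s * u))
           (fun u => expC (w * (u%:C)%C) *: ((s%:C)%C *: f (t + s * u))).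
Proof.
have s0 : s != 0 by apply: contra_eqN ss => /eqP ->; rewrite mul0r eq_sym oner_eq0.
have H := is_deriv_expC (w := w) (is_deriv_reparam (t := t) s0 dg).
move=> u; have := H u.
by rewrite mulNr scaleNr [_ *: (z *: _ + _)]scalerDr [_ *: (z *: _)]scalerA addKr.
Qed.

Lemma Re_weight : complex.Re w = - (s * complex.Re z).
Proof. by case: z => a b /=; rewrite oppr0 mul0r subr0 mulNr. Qed.

Lemma xnorm_weighted_deriv t u : (forall x, xnorm (f x) <= eps) ->
  xnorm (expC (w * (u%:C)%C) *: ((s%:C)%C *: f (t + s * u)))
  <= eps * expR (- (s * complex.Re z) * u).
Proof.
move=> feps; rewrite !xnormZ cabs_expC Re_mulr_real Re_weight cabsR.
have -> : `|s| = 1.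
  have := congr1 Num.norm ss; rewrite normrM normr1 -expr2 => /eqP.
  by rewrite sqrp_eq1 // => /eqP.
by rewrite mul1r mulrC ler_wpM2r ?expR_ge0.
Qed.

(** The mean value inequality bounds increments beyond [u] by [eps / d * exp (- d u)], which tends
    to 0; completeness of [X] then provides the limit. *)
Lemma cvg_weighted0 : 0 < s * complex.Re z -> (forall x, xnorm (f x) <= eps) ->
  exists C : X, expC (w * (u%:C)%C) *: g (0 + s * u) @[u --> +oo] --> C.
Proof.
move=> d0 feps; set d := s * _ in d0.
pose psi u := expC (w * (u%:C)%C) *: g (0 + s * u).
have eps0 : 0 <= eps := le_trans (xnorm_ge0 _) (feps 0).
have inc (u v : R) : u <= v -> xnorm (psi v - psi u) <= eps / d * expR (- d * u).
  move=> uv; pose G (x : R) : R := - (eps / d) * expR (- d * x).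
  have dG (x : R) : is_derive x 1 G (eps * expR (- d * x)).
    by have := is_derive_expRM (- (eps / d)) (- d) x; rewrite mulrNN divfK ?gt_eqF.
  have := mean_value_le uv (is_deriv_weighted (t := 0)) (fun x _ => dG x)
    (fun x _ => xnorm_weighted_deriv 0 x feps).
  move=> /le_trans; apply; rewrite /G !mulNr opprK addrC gerBl.
  by rewrite mulr_ge0 ?expR_ge0 // divr_ge0 // ltW.
have lim0 : eps / d * expR (- d * u) @[u --> +oo] --> (0 : R).
  by rewrite -(mulr0 (eps / d)); apply: cvgMl_tmp; exact: cvg_expRMy.
have : cvg (psi u @[u --> +oo]); last by move=> /cvg_ex.
apply: cauchy_cvg; apply: cauchy_exP => e e0.
have eE := gt0_complexE e0.
have e0' : 0 < complex.Re e by rewrite -(ltcR 0) -eE.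
have [u0 Hu0] : exists u0, eps / d * expR (- d * u0) < complex.Re e.
  apply: (@filter_ex _ (pinfty_nbhs R)); exact: cvgr_lt lim0 _ e0'.
exists (psi u0); rewrite /fmap /=.
apply: filterS (nbhs_pinfty_ge (num_real u0)) => v /= uv.
rewrite -ball_normE /ball_ /= normE eE ltcR xnormB.
exact: le_lt_trans (inc _ _ uv) Hu0.
Qed.

(** Since [s * s = 1], [t + s u = s (u + s t)]: changing the base point is a shift of [u], and the
    weight compensates by [exp (z t)]. Thus one limit [C] serves all [t]. *)
Lemma cvg_weighted (C : X) t :
  expC (w * (u%:C)%C) *: g (0 + s * u) @[u --> +oo] --> C ->
  expC (w * (u%:C)%C) *: g (t + s * u) @[u --> +oo] --> expC (z * (t%:C)%C) *: C.
Proof.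
move=> gC.
have E u : expC (w * (u%:C)%C) *: g (t + s * u) = expC (z * (t%:C)%C) *:
    (expC (w * ((u + s * t)%:C)%C) *: g (0 + s * (u + s * t))).
  have ssC : (s%:C)%C * (s%:C)%C = 1 by rewrite -rmorphM ss.
  have zt0 : z * (t%:C)%C + w * ((s * t)%:C)%C = 0.
    rewrite rmorphM /= mulNr mulNr mulrACA [z * _]mulrC.
    by rewrite mulrA ssC mul1r mulrC subrr.
  rewrite scalerA expC_mulD mulrA -expCD zt0 expC0 mul1r.
  by rewrite add0r mulrDr mulrA ss mul1r addrC.
under eq_fun do rewrite E.
by apply: cvgZl_tmp; rewrite (cvg_shiftr _ (fun u => expC (w * (u%:C)%C) *: g (0 + s * u))).
Qed.

End WeightedFactor.

(** * Splitting the equation of order [n] into first-order ones *)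

Section PartialFractionFactors.
Variables (R : realType) (X : normedModType R[i]) (n : nat).
Variables (a r : 'I_n -> R[i]) (y : R -> X) (ys : nat -> R -> X).
Hypotheses (ysCn : is_Cn n y ys) (rI : injective r).
Hypothesis rroot : forall k, root (charpoly a) (r k).

(* [Q(d/dt) y] with [Q = charpoly a / ('X - r k)]. *)
Definition factor (k : 'I_n) (t : R) : X :=
  \sum_(i < n) quot_coef n (charpoly a) (r k) i *: ys i t.

(** Differentiation raises each index of [ys] by one, that is, multiplies [Q] by ['X], and
    ['X * Q = charpoly a + r_k Q] because [r k] is a root. *)
Lemma is_deriv_factor k :
  is_deriv (factor k) (fun t => r k *: factor k t + Dop a ys t).
Proof.
have -> : (fun t => r k *: factor k t + Dop a ys t) =
    fun t => \sum_(i < n) quot_coef n (charpoly a) (r k) i *: ys i.+1 t.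
  apply/funext => t; rewrite (sum_quot_coef (ys^~ t) (size_charpoly a) (rroot k)).
  by rewrite (sum_charpoly a (ys^~ t)) addrC.
apply: is_deriv_sum => i; apply: is_derivZ.
by case: ysCn => _ [+ _]; apply.
Qed.

Lemma sum_pfrac_factor t : (0 < n)%N -> \sum_k pfrac r k *: factor k t = y t.
Proof.
case: ysCn => <- _ n0.
under eq_bigr do rewrite scaler_sumr.
rewrite exchange_big /= (bigD1 (Ordinal n0)) //= [X in _ + X]big1 ?addr0.
  under eq_bigr do rewrite scalerA.
  by rewrite -scaler_suml sum_pfrac_quot // scale1r.
move=> i i0; under eq_bigr do rewrite scalerA.
by rewrite -scaler_suml sum_pfrac_quot // -[_ == 0%N]/(i == Ordinal n0) (negPf i0) scale0r.
Qed.

Variables (p : nat) (eps : R).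
Hypothesis Dle : forall t, xnorm (Dop a ys t) <= eps.

(** The direction of time in which the weight [exp (- s_k r_k u)] decays. *)
Definition root_sign (k : 'I_n) : R := if (k < p)%N then 1 else -1.

Lemma root_signK k : root_sign k * root_sign k = 1.
Proof. by rewrite /root_sign; case: ifP; rewrite ?mulrNN mulr1. Qed.

(** All terms with [k < p] carry the same vector, [Dop] at [t + u], and all others carry [Dop] at
    [t - u] up to sign. Factoring these two vectors out before taking norms leaves exactly the two
    moduli of [kernel]. *)
Lemma xnorm_weighted_sum_le t u :
  xnorm (\sum_k pfrac r k *: (expC (- (root_sign k)%:C%C * r k * u%:C%C) *:
     ((root_sign k)%:C%C *: Dop a ys (t + root_sign k * u))))
  <= eps * (cabs (Vdm r))^-1 * kernel r p u.
Proof.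
(* The factor common to all [pfrac r k]; its modulus is the [1 / |V|] in front of the integral. *)
pose c : R[i] := (-1) ^+ n / Vdm r.
have pfE k : pfrac r k = c * kernel_coef r k.
  by rewrite /pfrac /kernel_coef /c exprD; ring.
have cc : cabs c = (cabs (Vdm r))^-1.
  rewrite cabsM; have -> : cabs ((-1) ^+ n : R[i]) = 1.
    by apply: (@complexI R); rewrite -cabs_normE normrX normrN1 expr1n.
  by rewrite mul1r; exact: Normc.normcV.
clearbody c.
pose T k := pfrac r k *: (expC (- (root_sign k)%:C%C * r k * u%:C%C) *:
  ((root_sign k)%:C%C *: Dop a ys (t + root_sign k * u))).
have posE : \sum_(k : 'I_n | (k < p)%N) T k =
    (c * exp_sum (fun k : 'I_n => (k < p)%N) (kernel_coef r) (fun k => -1 * r k) u)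
    *: Dop a ys (t + u).
  rewrite /exp_sum mulr_sumr scaler_suml; apply: eq_bigr => k kp.
  rewrite /T /root_sign kp rmorph1 scale1r mul1r scalerA pfE.
  by rewrite -(mulrA c).
have negE : \sum_(k : 'I_n | (p <= k)%N) T k =
    (- c * exp_sum (fun k : 'I_n => (p <= k)%N) (kernel_coef r) (fun k => 1 * r k) u)
    *: Dop a ys (t - u).
  rewrite /exp_sum mulr_sumr scaler_suml; apply: eq_bigr => k.
  rewrite leqNgt => /negPf kp.
  rewrite /T /root_sign kp rmorphN rmorph1 opprK mulN1r pfE.
  by rewrite scaleN1r scalerN scalerN scalerA !mulNr scaleNr -(mulrA c).
rewrite (bigID (fun k : 'I_n => (k < p)%N)) /= posE.
under [X in _ + X]eq_bigl do rewrite -leqNgt.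
rewrite negE.
have ge_eps (v : X) (b e : R) : 0 <= b -> xnorm v <= e -> b * xnorm v <= e * b.
  by move=> b0 ve; rewrite mulrC ler_wpM2r.
rewrite (le_trans (le_xnormD _ _)) // !xnormZ !cabsM.
have -> : cabs (- c) = cabs c by rewrite !cabs_xnorm xnormN.
rewrite cc /kernel mulrDr; apply: lerD.
  by rewrite -(mulrA eps) ge_eps // mulr_ge0 ?invr_ge0 ?cabs_ge0.
by rewrite -(mulrA eps) ge_eps // mulr_ge0 ?invr_ge0 ?cabs_ge0.
Qed.

End PartialFractionFactors.

(** * Existence and uniqueness of the kernel element *)

Lemma xnorm_le_sup (R : realType) (X : normedModType R[i]) (f : R -> X) (M : R) :
  (sup_norm f <= M%:E)%E <-> forall t, xnorm (f t) <= M.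
Proof.
split=> [fM t|fM].
  by rewrite -lee_fin (le_trans _ fM) //; apply: ereal_sup_ubound; exists t.
by apply: ge_ereal_sup => _ [t _ <-]; rewrite lee_fin.
Qed.

Lemma inKer_bounded_eq (R : realType) (X : normedModType R[i]) (n : nat)
  (r : 'I_n -> R[i]) (f1 f2 : R -> X) (M : R) :
  injective r -> (forall k, complex.Re (r k) != 0) ->
  inKer r f1 -> inKer r f2 -> (forall t, xnorm (f1 t - f2 t) <= M) -> f1 = f2.
Proof.
move=> rI r0 [C1 ->] [C2 ->] bM.
have C12 k : C1 k - C2 k = 0.
  apply: (@bounded_exp_sum R X _ r [set: 'I_n]%SET (fun i => C1 i - C2 i) M rI r0 _ k).
    move=> t; have := bM t; rewrite -sumrB.
    under eq_bigr do rewrite -scalerBr.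
    by under [in X in _ -> X]eq_bigl do rewrite inE.
  by rewrite inE.
apply/funext => t; apply: eq_bigr => k _.
by have /eqP := C12 k; rewrite subr_eq0 => /eqP ->.
Qed.

Local Close Scope classical_set_scope.
Unset Implicit Arguments.

Theorem theorem1 (R : realType) (X : completeNormedModType R[i]) (n : nat)
  (a : 'I_n -> R[i]) (r : 'I_n -> R[i]) (p : nat) (eps : R) :
  (0 < n)%N ->
  injective r ->
  (forall k, root (charpoly a) (r k)) ->
  (forall k, complex.Re (r k) != 0) ->
  (p <= n)%N ->
  (forall k : 'I_n, (0 < complex.Re (r k)) = (k < p)%N) ->
  0 < eps ->
  forall (y : R -> X) (ys : nat -> R -> X),
    is_Cn n y ys ->
    (sup_norm (Dop a ys) <= eps%:E)%E ->
    exists! yH : R -> X,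
      inKer r yH /\
      (sup_norm (fun t => (y t - yH t)%R) <= Kconst r p * eps%:E)%E.
Proof.
move=> n0 rI rroot r0 _ rp eps0 y ys ysCn /xnorm_le_sup Dle.
have V0 : 0 <= (cabs (Vdm r))^-1 by rewrite invr_ge0 cabs_ge0.
pose sg := @root_sign R n p; pose g := factor a r ys.
have dg k := is_deriv_factor ysCn rroot k.
pose w k := - (sg k)%:C%C * r k.
have sgr k : 0 < sg k * complex.Re (r k).
  rewrite /sg /root_sign -rp; case: ifPn; first by rewrite mul1r.
  by rewrite -leNgt mulN1r oppr_gt0 lt_neqAle r0.
have [C HC] := choice (fun k => cvg_weighted0 (root_signK R p k) (dg k) (sgr k) Dle).
pose yH t := \sum_k expC (r k * t%:C%C) *: (pfrac r k *: C k).
have yH_ker : inKer r yH by exists (fun k => pfrac r k *: C k).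
pose I := (\int[lebesgue_measure]_(u in `[0%R, +oo[) (kernel r p u)%:E)%E.
have I0 : (0 <= I)%E by apply: integral_ge0 => u _; rewrite lee_fin kernel_ge0.
(* Finiteness turns the bound [K eps] into a real number, as needed both for closeness and for
   uniqueness. *)
have Ifin : I \is a fin_num.
  by rewrite ge0_fin_numE //; exact: integral_kernel_lty.
have KE : (Kconst r p * eps%:E = ((cabs (Vdm r))^-1 * fine I * eps)%:E)%E.
  by rewrite Kconst_kernel // -/I -{1}(fineK Ifin).
have yH_close t : xnorm (y t - yH t) <= (cabs (Vdm r))^-1 * fine I * eps.
  pose Phi u := \sum_k pfrac r k *: (expC (w k * u%:C%C) *: g k (t + sg k * u)).
  pose Phi' u := \sum_k pfrac r k *: (expC (w k * u%:C%C) *: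
     ((sg k)%:C%C *: Dop a ys (t + sg k * u))).
  have dPhi : is_deriv Phi Phi'.
    apply: is_deriv_sum => k; apply: is_derivZ.
    exact: (is_deriv_weighted (t := t) (root_signK R p k) (dg k)).
  have Phi0 : Phi 0 = y t.
    rewrite /Phi -(sum_pfrac_factor a ysCn rI t n0); apply: eq_bigr => k _.
    by rewrite !mulr0 expC0 scale1r addr0.
  have Phioo : (Phi u @[u --> +oo] --> yH t)%classic.
    rewrite /yH; under eq_bigr do rewrite scalerA mulrC -scalerA.
    apply: cvg_big => [|k _]; first exact: add_continuous.
    by apply: cvgZl_tmp; apply: cvg_weighted (HC k); exact: root_signK.
  pose c := eps * (cabs (Vdm r))^-1.
  have c0 : 0 <= c by rewrite mulr_ge0 // ltW.
  have ck : continuous (fun u => c * kernel r p u).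
    by move=> u; apply: cvgMl_tmp; exact: continuous_kernel.
  have k0 u : 0 <= c * kernel r p u by rewrite mulr_ge0 // kernel_ge0.
  have kB u : 0 <= u -> xnorm (Phi' u) <= c * kernel r p u.
    by move=> _; exact: xnorm_weighted_sum_le.
  have := integral_dominates_increment dPhi ck k0 kB Phioo.
  rewrite Phi0 xnormB.
  under eq_integral do rewrite EFinM.
  rewrite ge0_integralZl_EFin //; last 2 first.
  - by move=> u _; rewrite lee_fin kernel_ge0.
  - apply/measurable_EFinP; apply: measurable_funTS.
    by apply: continuous_measurable_fun; exact: continuous_kernel.
  by rewrite -/I -(fineK Ifin) -EFinM lee_fin /c -(mulrA eps) (mulrC eps).
exists yH; split.
  by split => //; rewrite KE; apply/xnorm_le_sup.
move=> y' [y'_ker]; rewrite KE => /xnorm_le_sup y'_close.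
(* Both functions are within [K eps] of [y], so their difference is bounded by [2 K eps]. *)
apply: (@inKer_bounded_eq R X n r yH y' _ rI r0 yH_ker y'_ker) => t.
rewrite -(subrKA (y t)) -opprB (le_trans (le_xnormD _ _)) // xnormN.
exact: lerD (yH_close t) (y'_close t).
Qed.
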